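(* Let $X$ be a finite set with at least four elements and let $\Lambda$ be a nontrivial finite distributive lattice. Then for every field $k$, the monoid algebra $k\Lambda^{X\times X}$ of the monoid of $\Lambda$-generalized correspondences on $X$ is of infinite representation type.
   Context: A $\Lambda$-generalized correspondence on $X$ is a function $X\times X\to\Lambda$. The product of two such, $R$ and $S$, is defined by $RS(x,z)=\bigvee_{y\in X} R(x,y)\wedge S(y,z)$ for all $x,z\in X$; with this product the set $\Lambda^{X\times X}$ is a monoid. Nontrivial means $\Lambda$ has more than one element. A finite-dimensional $k$-algebra is of infinite representation type if it has infinitely many isomorphism classes of finite-dimensional indecomposable modules. *)

(* Defs.v *)
From HB Require Import structures.
From mathcomp Require Import all_boot all_order all_algebra.
Set Implicit Arguments. Unset Strict Implicit. Unset Printing Implicit Defensive.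
Import Order.TTheory GRing.Theory.

Section Corr.
Variables (d : Order.disp_t) (L : finTBDistrLatticeType d) (X : finType).

Definition corr := {ffun X * X -> L}.

Definition corr_mul (R S : corr) : corr :=
  [ffun p : X * X => (\join_(y : X) (R (p.1, y) `&` S (y, p.2)))%O].

Definition corr_one : corr :=
  [ffun p : X * X => if p.1 == p.2 then (\top)%O else (\bot)%O].
End Corr.

Section MonoidAlgebra.
Variables (d : Order.disp_t) (L : finTBDistrLatticeType d) (X : finType)
          (k : fieldType).
Local Open Scope ring_scope.

Definition malg := {ffun corr L X -> k}.

Definition malg_add (a b : malg) : malg := [ffun m => a m + b m].
Definition malg_scale (c : k) (a : malg) : malg := [ffun m => c * a m].
Definition malg_mul (a b : malg) : malg :=
  [ffun m => \sum_(p : corr L X) \sum_(q : corr L X | corr_mul p q == m)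
               a p * b q].
Definition malg_one : malg :=
  [ffun m => if m == corr_one L X then 1 else 0].

(* A left kA-module of k-dimension n (A the monoid algebra), in matrix form:
   a acts on row vectors v of k^n by v |-> v *m rho a. *)
Record malg_rep (n : nat) := MalgRep {
  rep_fun :> malg -> 'M[k]_n;
  rep_add : forall a b, rep_fun (malg_add a b) = rep_fun a + rep_fun b;
  rep_scale : forall c a, rep_fun (malg_scale c a) = c *: rep_fun a;
  rep_mul : forall a b, rep_fun (malg_mul a b) = rep_fun b *m rep_fun a;
  rep_one : rep_fun malg_one = 1%:M
}.

Definition fdmod := {n : nat & malg_rep n}.

Definition submod n (rho : malg_rep n) (U : 'M[k]_n) : Prop :=
  forall a, (U *m rho a <= U)%MS.

Definition indecomposable (M : fdmod) : Prop :=
  (0 < projT1 M)%N /\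
  forall U W : 'M[k]_(projT1 M),
    submod (projT2 M) U -> submod (projT2 M) W ->
    \rank (U :&: W)%MS = 0%N -> \rank (U + W)%MS = projT1 M ->
    \rank U = 0%N \/ \rank W = 0%N.

Definition mod_iso (M N : fdmod) : Prop :=
  exists (P : 'M[k]_(projT1 M, projT1 N)) (Q : 'M[k]_(projT1 N, projT1 M)),
    P *m Q = 1%:M /\ Q *m P = 1%:M /\
    forall a, projT2 M a *m P = P *m projT2 N a.

Definition finite_rep_type : Prop :=
  exists s : seq fdmod,
    forall M : fdmod, indecomposable M -> exists2 i, (i < size s)%N & mod_iso M (nth M s i).

Definition infinite_rep_type : Prop := ~ finite_rep_type.
End MonoidAlgebra.

(* Main.v *)
Require Import Defs.
From HB Require Import structures.
From mathcomp Require Import all_boot all_order all_algebra.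
From mathcomp Require Import perm.
Set Implicit Arguments. Unset Strict Implicit. Unset Printing Implicit Defensive.
Import Order.TTheory GRing.Theory.

(* A join-prime element of L gives a surjective morphism from the monoid of
   generalized correspondences onto the monoid of Boolean relations on X. In the
   latter, for a cycle c of length at least 3, the union of the diagonal and the
   graph of c is a prime: if it factors as r s, then r or s is a permutation. The
   primes p, q given by a 3-cycle and a 4-cycle are not equivalent under
   permutations. Hence sending permutations to 1, the orbit of p to x, the orbit
   of q to y and all other relations to 0 is a morphism onto k[x, y] / (x, y)^2.
   The latter algebra has an indecomposable module of dimension 2 n for every
   n > 0, on which x and y act by [[0, 1], [0, 0]] and [[0, J], [0, 0]], with J a
   nilpotent Jordan block of size n. *)

(** * Prime Boolean relations *)

Section BooleanRelations.
Variable X : finType.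
Implicit Types (r s p : X -> X -> bool) (t : seq X).

Definition relcomp r s x z := [exists y, r x y && s y z].

Definition is_perm_rel r :=
  [exists u : {perm X}, [forall x, [forall y, r x y == (u x == y)]]].

Definition perm_equiv p r :=
  [exists u : {perm X}, [exists v : {perm X},
    [forall x, [forall y, r x y == p (u x) (v y)]]]].

Lemma is_perm_relP r :
  reflect (exists u : {perm X}, forall x y, r x y = (u x == y)) (is_perm_rel r).
Proof.
apply: (iffP existsP) => -[u].
  by move=> h; exists u => x y; move/forallP: h => /(_ x)/forallP/(_ y)/eqP.
by move=> h; exists u; apply/forallP=> x; apply/forallP=> y; rewrite h.
Qed.

Lemma perm_equivP p r :
  reflect (exists u v : {perm X}, forall x y, r x y = p (u x) (v y))
          (perm_equiv p r).
Proof.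
apply: (iffP existsP) => -[u].
  case/existsP=> v h; exists u, v => x y.
  by move/forallP: h => /(_ x)/forallP/(_ y)/eqP.
case=> v h; exists u; apply/existsP; exists v.
by apply/forallP=> x; apply/forallP=> y; rewrite h.
Qed.

Lemma relcomp_perml r s (w : {perm X}) x z :
  (forall x y, r x y = (w x == y)) -> relcomp r s x z = s (w x) z.
Proof.
move=> rE; apply/existsP/idP => [[y]|h]; first by rewrite rE => /andP[/eqP->].
by exists (w x); rewrite rE eqxx.
Qed.

Lemma relcomp_permr r s (w : {perm X}) x y :
  (forall y z, s y z = (w y == z)) -> relcomp r s x (w y) = r x y.
Proof.
move=> sE; apply/existsP/idP => [[y']|h]; last by exists y; rewrite sE eqxx andbT.
by rewrite sE => /andP[h /eqP/perm_inj<-].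
Qed.

(** If the composite is the graph of w, a choice of midpoints f x between x and w x is injective
    because w is, hence bijective. Every edge of r then has the form (x, f x), and s is the inverse
    of f followed by w. *)
Lemma is_perm_relcomp r s :
  is_perm_rel (relcomp r s) = is_perm_rel r && is_perm_rel s.
Proof.
apply/is_perm_relP/andP => [[w wE]|[/is_perm_relP[u uE] /is_perm_relP[v vE]]];
  last first.
  by exists (u * v)%g => x z; rewrite (relcomp_perml _ _ _ uE) vE permM.
have/fin_all_exists[f fP] x : exists y, r x y && s y (w x).
  by apply/existsP; rewrite -/(relcomp r s x (w x)) wE eqxx.
have rf x : r x (f x) by case/andP: (fP x).
have sf x : s (f x) (w x) by case/andP: (fP x).
have cw x y z : r x y -> s y z -> w x = z.
  by move=> h1 h2; apply/eqP; rewrite -wE; apply/existsP; exists y; rewrite h1.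
have f_inj : injective f.
  by move=> x x' e; apply: (@perm_inj _ w); apply: cw (rf x) _; rewrite e.
have [g fK gK] := injF_bij f_inj.
have rE x y : r x y = (perm f_inj x == y).
  rewrite permE; apply/idP/eqP => [h|<-//]; rewrite -(gK y); congr f.
  by apply: (@perm_inj _ w); apply: cw h _; rewrite -{1}(gK y).
split; apply/is_perm_relP; first by exists (perm f_inj).
exists ((perm f_inj)^-1 * w)%g => y z.
by rewrite permM -wE (relcomp_perml _ _ _ rE) permKV.
Qed.

(** Permutations satisfy this too, by [is_perm_relcomp]; a nonzero [branching] rules them out
    later. *)
Definition prime_rel p := forall r s,
  (forall x z, relcomp r s x z = p x z) -> is_perm_rel r \/ is_perm_rel s.

(** Absorbing u and v into the outer sides of r and s turns a factorization of an element of the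
    orbit into one of p. One factor is thus a permutation, and cancelling it puts the other in the
    orbit of p. *)
Lemma perm_equiv_relcomp p r s : prime_rel p ->
  perm_equiv p (relcomp r s) =
    (is_perm_rel r && perm_equiv p s) || (perm_equiv p r && is_perm_rel s).
Proof.
move=> p_prime; apply/idP/orP; last first.
  case=> /andP[].
    move=> /is_perm_relP[w wE] /perm_equivP[u [v uv]]; apply/perm_equivP.
    by exists (w * u)%g, v => x y; rewrite (relcomp_perml _ _ _ wE) uv permM.
  move=> /perm_equivP[u [v uv]] /is_perm_relP[w wE]; apply/perm_equivP.
  exists u, (w^-1 * v)%g => x y; rewrite -{1}(permKV w y).
  by rewrite (relcomp_permr _ _ _ wE) uv permM.
case/perm_equivP=> u [v uv].
pose r' x y := r ((u^-1)%g x) y; pose s' y z := s y ((v^-1)%g z).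
have : is_perm_rel r' \/ is_perm_rel s'.
  apply: p_prime => x z; rewrite -{2}(permKV u x) -{2}(permKV v z) -uv.
  by apply/eq_existsb=> y.
case=> /is_perm_relP[w wE]; [left|right].
  have rE x y : r x y = ((u * w)%g x == y) by rewrite permM -wE /r' permK.
  apply/andP; split; first by apply/is_perm_relP; exists (u * w)%g.
  apply/perm_equivP; exists ((u * w)^-1 * u)%g, v => y z.
  by rewrite permM -uv (relcomp_perml _ _ _ rE) permKV.
have sE y z : s y z = ((w * v^-1)%g y == z).
  by rewrite permM -{1}(permK v z) -/(s' _ _) wE (canF_eq (permKV v)).
apply/andP; split; last by apply/is_perm_relP; exists (w * v^-1)%g.
apply/perm_equivP; exists u, (w * v^-1 * v)%g => x y.
by rewrite permM -uv (relcomp_permr _ _ _ sE).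
Qed.

(** An orbit invariant that separates the two primes from each other and from the permutations. *)
Definition branching r := #|[set x | 1 < #|[set y | r x y]|]|.

Lemma branching_perm r : is_perm_rel r -> branching r = 0.
Proof.
move=> /is_perm_relP[u uE]; apply: eq_card0 => x; rewrite !inE.
rewrite (_ : [set y | _] = [set u x]) ?cards1 //.
by apply/setP=> y; rewrite !inE uE eq_sym.
Qed.

Lemma branching_perm_equiv p r : perm_equiv p r -> branching r = branching p.
Proof.
case/perm_equivP=> u [v uv]; rewrite /branching -[RHS](card_preimset _ (@perm_inj _ u)).
apply: eq_card => x; rewrite !inE -[in RHS](card_preimset _ (@perm_inj _ v)).
by congr (_ < _); apply: eq_card => y; rewrite !inE uv.
Qed.

(** * Relations attached to cycles *)

Definition cycle_rel t x y := (y == x) || (y == next t x).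

Section Cycle.
Variable t : seq X.
Hypotheses (Ut : uniq t) (t_gt2 : 2 < size t).
Let c := next t.

Let c_inj : injective c. Proof. exact: can_inj (prev_next Ut). Qed.

Lemma next_iter x y : x \in t -> y \in t -> exists k, y = iter k c x.
Proof.
move=> xt yt; exists (findex c x y); rewrite iter_findex //.
by rewrite (fconnect_cycle (cycle_next Ut) xt).
Qed.

Lemma next_notin x : x \notin t -> c x = x.
Proof. by move=> xt; rewrite /c next_nth (negPf xt). Qed.

(** The orbit of a point of t is all of t, which has more than the two elements x and c x. *)
Lemma next_next_neq x : c (c x) = x -> x \notin t.
Proof.
move=> ccx; apply: contraL t_gt2 => xt; rewrite -leqNgt.
apply: (@uniq_leq_size _ t [:: x; c x] Ut) => y yt.
have [k ->] := next_iter xt yt.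
elim: k => [|k]; first by rewrite mem_head.
by rewrite iterS !inE => /orP[]/eqP->; rewrite ?ccx eqxx ?orbT.
Qed.

Lemma next_next_id x : c (c x) = x -> c x = x.
Proof. by move/next_next_neq/next_notin. Qed.

Lemma next_neq x : (c x != x) = (x \in t).
Proof.
apply/idP/idP; first by apply: contraR => /next_notin->.
by apply: contraL => /eqP e; apply: next_next_neq; rewrite !e.
Qed.

(** A moved point x0 has f x0 = c x0. Once f y = c y, injectivity forbids f to fix c y unless c y =
    y, so f follows c along the whole cycle; off t, c is the identity. *)
Lemma id_or_next (f : X -> X) : injective f ->
  (forall x, f x = x \/ f x = c x) -> f =1 id \/ f =1 c.
Proof.
move=> f_inj fP; have [/forallP h|/forallPn[x0 nx0]] := boolP [forall x, f x == x].
  by left=> x; apply/eqP.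
right=> x; have fx0 : f x0 = c x0 by case: (fP x0) nx0 => // ->; rewrite eqxx.
have x0t : x0 \in t by rewrite -next_neq -fx0.
have [xt|/next_notin cx] := boolP (x \in t); last by case: (fP x); rewrite // cx.
have [k ->] := next_iter x0t xt; elim: k => //= k IH.
case: (fP (c (iter k c x0))) => // e.
have e' : c (iter k c x0) = iter k c x0 by apply: f_inj; rewrite e IH.
by rewrite e !e'.
Qed.

Lemma branching_cycle : branching (cycle_rel t) = size t.
Proof.
rewrite -(card_uniqP Ut); apply: eq_card => x; rewrite !inE -next_neq.
rewrite (_ : [set y | _] = [set x; c x]); last by apply/setP=> y; rewrite !inE.
by rewrite cards2 eq_sym; case: eqP.
Qed.

(* A factorization covers the bipartite graph of [cycle_rel t] by #|X| complete
   bipartite subgraphs. The edges (x, x), and likewise the edges (x, next t x),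
   pairwise need different subgraphs, because t has no 2-cycle; comparing the
   two resulting bijections shows that all subgraphs are stars centred on the
   same side. *)
Lemma prime_cycle_rel : prime_rel (cycle_rel t).
Proof.
move=> r s rsE.
have rsP x y z : r x y -> s y z -> z = x \/ z = c x.
  move=> rxy syz; have : cycle_rel t x z.
    by rewrite -rsE; apply/existsP; exists y; rewrite rxy.
  by case/orP=> /eqP; [left|right].
have cov z x : z = x \/ z = c x -> exists y, r x y && s y z.
  move=> h; apply/existsP; rewrite -/(relcomp r s x z) rsE /cycle_rel.
  by case: h => ->; rewrite eqxx ?orbT.
have/fin_all_exists[f fP] x : exists y, r x y && s y x by apply: cov; left.
have/fin_all_exists[g gP] x : exists y, r x y && s y (c x) by apply: cov; right.
have rf x : r x (f x) by case/andP: (fP x).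
have sf x : s (f x) x by case/andP: (fP x).
have rg x : r x (g x) by case/andP: (gP x).
have sg x : s (g x) (c x) by case/andP: (gP x).
have f_inj : injective f.
  move=> x x' e; have [//|e1] : x = x' \/ x = c x'.
    by apply: (rsP _ (f x')); rewrite // -e.
  have [//|e2] : x' = x \/ x' = c x.
    by apply: (rsP _ (f x)); rewrite // e.
  by rewrite e1 next_next_id // -e1 -e2.
have g_inj : injective g.
  move=> x x' e; have [|/c_inj//] : c x = x' \/ c x = c x'.
    by apply: (rsP _ (g x')); rewrite // -e.
  move=> e1; have [|/c_inj//] : c x' = x \/ c x' = c x.
    by apply: (rsP _ (g x)); rewrite // e.
  by move=> e2; rewrite -e1 next_next_id // e1.
have [f' fK f'K] := injF_bij f_inj.
(* [f'] finds the diagonal edge whose midpoint is that of (x, c x); its endpoint is x or c x. *)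
have [] := @id_or_next (f' \o g).
- exact: inj_comp (can_inj f'K) g_inj.
- by move=> x /=; apply: (rsP _ (g x)); rewrite // -{1}(f'K (g x)).
(* Here (x, x) and (x, c x) share a midpoint: the stars are centred on the left, and r is the graph
   of f. *)
- move=> e; have gE x : g x = f x by rewrite -(f'K (g x)) [f' _]e.
  left; apply/is_perm_relP; exists (perm f_inj) => x y; rewrite permE.
  apply/idP/eqP => [|<-//]; rewrite -(f'K y); move: (f' y) => z h; congr f.
  have [//|zx] := rsP _ _ _ h (sf z).
  have [|/c_inj//] : c z = x \/ c z = c x by apply: (rsP _ (f z)); rewrite // -gE.
  by move=> zx'; rewrite zx next_next_id // -zx.
(* Here (x, c x) and (c x, c x) share a midpoint: the stars are centred on the right, and s is the
   graph of [f']. *)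
move=> e; have gE x : g x = f (c x) by rewrite -(f'K (g x)) [f' _]e.
right; apply/is_perm_relP; exists (perm (can_inj f'K)) => y z; rewrite permE.
apply/idP/eqP => [|<-]; last by rewrite -{1}(f'K y).
rewrite -{1}(f'K y); move: (f' y) => w; rewrite -(next_prev Ut w) -/c.
move: (prev t w) => x h.
have [zx|-> //] : z = x \/ z = c x by apply: rsP h; rewrite -gE.
have [->//|zx'] := rsP _ _ _ (rf (c x)) h.
by rewrite zx next_next_id // -zx' zx.
Qed.

End Cycle.

End BooleanRelations.

Lemma eq_is_perm_rel (X : finType) (r s : X -> X -> bool) :
  r =2 s -> is_perm_rel r = is_perm_rel s.
Proof.
by move=> e; apply: eq_existsb => u; do 2!apply: eq_forallb => ?; rewrite e.
Qed.

Lemma eq_perm_equiv (X : finType) (p r s : X -> X -> bool) :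
  r =2 s -> perm_equiv p r = perm_equiv p s.
Proof.
by move=> e; do 2!apply: eq_existsb => ?; do 2!apply: eq_forallb => ?; rewrite e.
Qed.

(** * From generalized correspondences to Boolean relations *)

(** An atom works: its meet with any z is itself or bottom, and meets distribute over joins. *)
Lemma exists_join_prime (d : Order.disp_t) (L : finTBDistrLatticeType d) :
  1 < #|L| -> exists2 a : L, a != \bot%O
    & forall x y, (a <= x `|` y)%O = (a <= x)%O || (a <= y)%O.
Proof.
move=> L_gt1.
have [x0 x0P] : exists x0 : L, x0 != \bot%O.
  apply/existsP; apply: contraTT L_gt1 => /existsPn bot; rewrite -leqNgt.
  apply/card_le1_eqP => x y _ _.
  by move: (bot x) (bot y); rewrite !negbK => /eqP-> /eqP->.
(* A non-bottom element with the fewest elements below it is an atom. *)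
have [a a_neq0 a_min] :=
  @arg_minnP L x0 (fun x => x != \bot%O) (fun x => #|[set y : L | (y <= x)%O]|) x0P.
exists a => // x y.
have min b : (b <= a)%O -> b != \bot%O -> b = a.
  move=> ba /a_min; rewrite leqNgt => h; apply/eqP; apply: contraNT h => ne.
  apply: proper_card; apply/properP; split.
    by apply/subsetP=> z; rewrite !inE => /le_trans->.
  by exists a; rewrite !inE ?lexx // lt_geF // lt_neqAle ne.
apply/idP/orP => [h|[]/le_trans->//]; [|exact: leUl|exact: leUr].
have le_or z : (a <= z)%O \/ (a `&` z = \bot)%O.
  have [e|/(min _ (leIl _ _)) e] := eqVneq (a `&` z)%O \bot%O; first by right.
  by left; rewrite leEmeet e.
case: (le_or x) => [|ex]; first by left.
case: (le_or y) => [|ey]; first by right.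
by move: h a_neq0; rewrite leEmeet meetUr ex ey joinx0 eq_sym => ->.
Qed.

Section Shadow.
Variables (d : Order.disp_t) (L : finTBDistrLatticeType d) (X : finType).
Variable a : L.
Hypotheses (a_neq0 : a != \bot%O)
  (a_prime : forall x y, (a <= x `|` y)%O = (a <= x)%O || (a <= y)%O).

(* As a is join-prime, x |-> (a <= x) is a lattice morphism from L to bool, so
   [shadow] is a morphism onto the monoid of Boolean relations. *)
Definition shadow (R : corr L X) x y := (a <= R (x, y))%O.

Lemma shadow_mul R S : shadow (corr_mul R S) =2 relcomp (shadow R) (shadow S).
Proof.
move=> x z; rewrite /shadow ffunE /= (big_morph _ a_prime (lex0 _)).
by rewrite (negPf a_neq0) big_orE; apply: eq_existsb => y; rewrite lexI.
Qed.

Lemma shadow_one : shadow (corr_one L X) =2 (fun x y => x == y).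
Proof.
move=> x y; rewrite /shadow ffunE /=; case: eqP => _; first exact: lex1.
by rewrite lex0 (negPf a_neq0).
Qed.

Lemma shadow_surj (r : X -> X -> bool) : exists R, shadow R =2 r.
Proof.
exists [ffun q => if r q.1 q.2 then \top%O else \bot%O] => x y.
by rewrite /shadow ffunE /=; case: (r x y); rewrite ?lex1 // lex0 (negPf a_neq0).
Qed.

End Shadow.

Local Open Scope ring_scope.

(** * Modules from matrix representations of the monoid *)

Section MonoidRep.
Variables (d : Order.disp_t) (L : finTBDistrLatticeType d) (X : finType).
Variables (k : fieldType) (n : nat) (f : corr L X -> 'M[k]_n).
Hypotheses (f_mul : forall R S, f (corr_mul R S) = f S *m f R)
           (f_one : f (corr_one L X) = 1%:M).

Definition linear_ext (a : malg L X k) := \sum_R a R *: f R.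

Fact linear_ext_add a b :
  linear_ext (malg_add a b) = linear_ext a + linear_ext b.
Proof.
by rewrite -big_split; apply: eq_bigr => R _; rewrite ffunE scalerDl.
Qed.

Fact linear_ext_scale c a : linear_ext (malg_scale c a) = c *: linear_ext a.
Proof. by rewrite scaler_sumr; apply: eq_bigr => R _; rewrite ffunE scalerA. Qed.

Fact linear_ext_mul a b : linear_ext (malg_mul a b) = linear_ext b *m linear_ext a.
Proof.
rewrite [RHS]mulmx_suml [RHS](eq_bigr _ (fun S _ => mulmx_sumr _ _ _ _)).
rewrite [RHS]exchange_big /= /linear_ext.
under [LHS]eq_bigr => T _ do rewrite ffunE scaler_suml.
rewrite [LHS]exchange_big; apply: eq_bigr => R _ /=.
under [LHS]eq_bigr => T _ do rewrite scaler_suml.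
(* For fixed R and S, only T = R S contributes. *)
rewrite [LHS](exchange_big_dep xpredT) //=; apply: eq_bigr => S _.
rewrite (big_pred1 (corr_mul R S)) => [|T]; last by rewrite /= eq_sym.
by rewrite f_mul -scalemxAl -scalemxAr scalerA mulrC.
Qed.

Lemma linear_ext_delta R : linear_ext [ffun S => (S == R)%:R] = f R.
Proof.
rewrite /linear_ext (bigD1 R) //= ffunE eqxx scale1r big1 ?addr0 // => S neq.
by rewrite ffunE (negPf neq) scale0r.
Qed.

Fact linear_ext_one : linear_ext (malg_one L X k) = 1%:M.
Proof.
rewrite -f_one -linear_ext_delta; congr linear_ext.
by apply/ffunP=> S; rewrite !ffunE; case: eqP.
Qed.

Definition monoid_rep : malg_rep L X k n :=
  MalgRep linear_ext_add linear_ext_scale linear_ext_mul linear_ext_one.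

End MonoidRep.

(** With P + Q = 1 the two projections, A = P A + Q A; the first term lands in U, where P is the
    identity, the second in W, which P kills. *)
Lemma proj_mx_comm (k : fieldType) n (U W A : 'M[k]_n) :
  (U :&: W = 0)%MS -> row_full (U + W)%MS ->
  (U *m A <= U)%MS -> (W *m A <= W)%MS ->
  A *m proj_mx U W = proj_mx U W *m A.
Proof.
move=> dxUW fullUW sUA sWA; set P := proj_mx U W.
have sP : (P *m A <= U)%MS.
  by apply: submx_trans sUA; apply: submxMr; rewrite -[P]mul1mx proj_mx_sub.
have PD : P + proj_mx W U = 1%:M.
  by rewrite -[LHS]mul1mx mulmxDr add_proj_mx // submx_full.
have sQ : (proj_mx W U *m A <= W)%MS.
  by apply: submx_trans sWA; apply: submxMr; rewrite -[proj_mx W U]mul1mx proj_mx_sub.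
rewrite -[A in LHS]mul1mx -PD mulmxDl mulmxDl (proj_mx_id _ sP) //.
by rewrite proj_mx_0 // addr0.
Qed.

(** * Kronecker modules *)

Section Kronecker.
Variables (k : fieldType) (n : nat).

Definition jordan : 'M[k]_n.+1 := \matrix_(i, j) (j == i.+1 :> nat)%:R.

(** The shape of the actions of x and y: the first half goes to the second, the second to 0, so that
    products vanish. *)
Definition corner (A : 'M[k]_n.+1) : 'M[k]_(n.+1 + n.+1) := block_mx 0 A 0 0.

Lemma corner_mul A B : corner A *m corner B = 0.
Proof. by rewrite mulmx_block !mul0mx !mulmx0 !addr0 block_mx0. Qed.

Lemma mulmx_jordan (v : 'rV_n.+1) (i : 'I_n.+1) (lt_in : (i.+1 < n.+1)%N) :
  (v *m jordan) 0 (Ordinal lt_in) = v 0 i.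
Proof.
rewrite mxE (bigD1 i) //= mxE eqxx mulr1 big1 ?addr0 // => j ne.
by rewrite mxE /= eqSS eq_sym val_eqE (negPf ne) mulr0.
Qed.

Lemma mulmx_jordan0 (v : 'rV_n.+1) : (v *m jordan) 0 0 = 0.
Proof. by rewrite mxE big1 // => j _; rewrite mxE mulr0. Qed.

Lemma ker_jordan (v : 'rV_n.+1) :
  v *m jordan = 0 -> v = v 0 ord_max *: delta_mx 0 ord_max.
Proof.
move=> vJ0; apply/rowP=> i; rewrite !mxE eqxx /=.
have [->|ne] := eqVneq i ord_max; first by rewrite mulr1.
have lt_in : (i.+1 < n.+1)%N by rewrite ltnS ltn_neqAle ne -ltnS /=.
by rewrite mulr0 -(mulmx_jordan v lt_in) vJ0 mxE.
Qed.

(* The last basis vector spans the kernel of J, so it is an eigenvector of a;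
   once a kills it, a kills the kernels of all powers of J in turn. *)
Lemma idempotent_comm_jordan (a : 'M[k]_n.+1) :
  a *m a = a -> a *m jordan = jordan *m a -> a = 0 \/ a = 1%:M.
Proof.
have key (b : 'M[k]_n.+1) : b *m b = b -> b *m jordan = jordan *m b ->
    (delta_mx 0 ord_max : 'rV_n.+1) *m b = 0 -> b = 0.
  move=> bb bJ b0.
  (* The vectors v supported in the last m coordinates form the kernel of the m-th power of J. *)
  have kills m (v : 'rV_n.+1) :
      (forall i : 'I_n.+1, (i + m < n.+1)%N -> v 0 i = 0) -> v *m b = 0.
    elim: m v => [|m IH] v v0.
      by rewrite (_ : v = 0) ?mul0mx //; apply/rowP=> i; rewrite v0 ?mxE ?addn0.
    have vbJ0 : v *m b *m jordan = 0.
      rewrite -mulmxA bJ mulmxA; apply: IH => -[[|i] lti] ltim.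
        by rewrite (_ : Ordinal _ = 0) ?mulmx_jordan0 //; apply: val_inj.
      have lti' : (i < n.+1)%N by apply: ltnW.
      rewrite (@mulmx_jordan v (Ordinal lti')) v0 //=.
      by rewrite addnS -addSn.
    (* [v *m b] is a multiple of the last basis vector, which b kills; b being idempotent, [v *m b]
       is itself 0. *)
    by rewrite -bb mulmxA (ker_jordan vbJ0) -scalemxAl b0 scaler0.
  apply/row_matrixP=> i; rewrite rowE (kills n.+1) ?row0 // => j.
  by rewrite ltnNge leq_addl.
move=> aa aJ; pose v : 'rV[k]_n.+1 := delta_mx 0 ord_max.
have vJ : v *m jordan = 0.
  rewrite -rowE; apply/rowP=> j; rewrite !mxE /=.
  by rewrite ltn_eqF // ltn_ord.
have /ker_jordan va : v *m a *m jordan = 0 by rewrite -mulmxA aJ mulmxA vJ mul0mx.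
set c := (v *m a) 0 ord_max in va; rewrite -/v in va.
have cc : c * c = c.
  by rewrite {3}/c -aa mulmxA va -scalemxAl va scalerA !mxE !eqxx mulr1.
have /eqP : c * (c - 1) = 0 by rewrite mulrBr cc mulr1 subrr.
rewrite mulf_eq0 subr_eq0 => /orP[]/eqP c01.
  by left; apply: key; rewrite // va c01 scale0r.
(* For eigenvalue 1, the idempotent 1 - a kills the last basis vector. *)
right; apply/eqP; rewrite eq_sym -subr_eq0; apply/eqP; apply: key.
- by rewrite mulmxBl mul1mx mulmxBr mulmx1 aa subrr subr0.
- by rewrite mulmxBl mulmxBr mul1mx mulmx1 aJ.
- by rewrite mulmxBr mulmx1 -/v va c01 scale1r subrr.
Qed.

(* A matrix commuting with [corner 1] is block triangular with equal diagonal
   blocks. *)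
Lemma idempotent_comm_corner (P : 'M[k]_(n.+1 + n.+1)) : P *m P = P ->
  corner 1%:M *m P = P *m corner 1%:M ->
  corner jordan *m P = P *m corner jordan -> P = 0 \/ P = 1%:M.
Proof.
have [a [b [c [e ->]]]] : exists a b c e, P = block_mx a b c e.
  by exists (ulsubmx P), (ursubmx P), (dlsubmx P), (drsubmx P); rewrite submxK.
rewrite !mulmx_block !mul0mx !mulmx0 !mulmx1 !mul1mx !add0r !addr0.
move=> PP /eq_block_mx[c0 ea _ _] /eq_block_mx[_ aJ _ _]; subst c e.
move: PP; rewrite !mul0mx !mulmx0 !addr0 add0r => /eq_block_mx[aa ab _ _].
(* The upper right block of P P = P reads a b + b a = b. *)
have b0 : a = 0 \/ a = 1%:M -> b = 0.
  case=> ea; move: ab; rewrite ea ?mul0mx ?mulmx0 ?mul1mx ?mulmx1 ?addr0 //.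
  by move/(canRL (addKr b)); rewrite addNr.
have [a01|a01] := idempotent_comm_jordan aa (esym aJ).
  by left; rewrite b0 a01 ?block_mx0 //; left.
by right; rewrite b0 a01 ?scalar_mx_block //; right.
Qed.

(** The projection onto U along W is an idempotent commuting with both actions, hence 0 or 1. *)
Lemma corner_indecomposable (U W : 'M[k]_(n.+1 + n.+1)) :
  (U *m corner 1%:M <= U)%MS -> (W *m corner 1%:M <= W)%MS ->
  (U *m corner jordan <= U)%MS -> (W *m corner jordan <= W)%MS ->
  (U :&: W = 0)%MS -> row_full (U + W)%MS -> U = 0 \/ W = 0.
Proof.
move=> U1 W1 UJ WJ dxUW fullUW; set P := proj_mx U W.
have [||| P0|P1] := @idempotent_comm_corner P.
- by rewrite proj_mx_id // -[P]mul1mx proj_mx_sub.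
- exact: proj_mx_comm.
- exact: proj_mx_comm.
- left; have <- : U *m P = U by rewrite proj_mx_id.
  by rewrite P0 mulmx0.
by right; rewrite -[W]mulmx1 -P1 proj_mx_0.
Qed.

End Kronecker.

(** * Kronecker modules over the monoid algebra *)

Section KroneckerModule.
Variables (d : Order.disp_t) (L : finTBDistrLatticeType d) (X : finType).
Variables (k : fieldType) (a : L).
Hypotheses (a_neq0 : a != \bot%O)
  (a_prime : forall x y, (a <= x `|` y)%O = (a <= x)%O || (a <= y)%O).
Variables p q : X -> X -> bool.
Hypotheses (p_prime : prime_rel p) (q_prime : prime_rel q).
Hypotheses (p_gt0 : branching p != 0%N) (q_gt0 : branching q != 0%N)
  (neq_pq : branching p != branching q).
Variable n : nat.

(** The morphism to k[x, y] / (x, y)^2 followed by the action on the module; by [rel_exclusive] the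
    order of the tests is immaterial. *)
Definition kronecker_mx (R : corr L X) : 'M[k]_(n.+1 + n.+1) :=
  if is_perm_rel (shadow a R) then 1%:M
  else if perm_equiv p (shadow a R) then corner 1%:M
  else if perm_equiv q (shadow a R) then corner (jordan k n) else 0.

(** [branching] takes three distinct values on the three classes. *)
Lemma rel_exclusive (r : X -> X -> bool) :
  [/\ is_perm_rel r && perm_equiv p r = false,
      is_perm_rel r && perm_equiv q r = false
    & perm_equiv p r && perm_equiv q r = false].
Proof.
split; apply/negP=> /andP[].
- move=> /branching_perm r0 /branching_perm_equiv rp.
  by move: p_gt0; rewrite -rp r0.
- move=> /branching_perm r0 /branching_perm_equiv rq.
  by move: q_gt0; rewrite -rq r0.
- move=> /branching_perm_equiv rp /branching_perm_equiv rq.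
  by move: neq_pq; rewrite -rp -rq eqxx.
Qed.

Lemma kronecker_mx_mul R S :
  kronecker_mx (corr_mul R S) = kronecker_mx S *m kronecker_mx R.
Proof.
rewrite /kronecker_mx.
have RS := shadow_mul a_neq0 a_prime R S.
rewrite (eq_is_perm_rel RS) !(eq_perm_equiv _ RS) is_perm_relcomp.
rewrite !perm_equiv_relcomp //.
have [] := rel_exclusive (shadow a R); have [] := rel_exclusive (shadow a S).
(* Each factor is a permutation, in the orbit of p, in that of q, or none of these; two
   non-permutations give 0 on both sides. *)
do 3!case: (_ (shadow a R)) => //=; do 3!case: (_ (shadow a S)) => //=;
  by rewrite ?mulmx1 ?mul1mx ?mulmx0 ?mul0mx ?corner_mul.
Qed.

Lemma kronecker_mx_one : kronecker_mx (corr_one L X) = 1%:M.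
Proof.
rewrite /kronecker_mx (eq_is_perm_rel (shadow_one a_neq0)) ifT //.
by apply/is_perm_relP; exists 1%g => x y; rewrite perm1.
Qed.

Definition kronecker_module : fdmod L X k :=
  existT _ (n.+1 + n.+1)%N (monoid_rep kronecker_mx_mul kronecker_mx_one).

Lemma kronecker_module_indecomposable : indecomposable kronecker_module.
Proof.
split=> //= U W subU subW capUW addUW.
have equiv_refl (r : X -> X -> bool) : perm_equiv r r.
  by apply/perm_equivP; exists 1%g, 1%g => x y; rewrite !perm1.
have [Rp RpE] := shadow_surj a_neq0 p.
have [Rq RqE] := shadow_surj a_neq0 q.
have [/= pp _ _] := rel_exclusive p; have [/= _ qq _] := rel_exclusive q.
have [/= _ _ pq'] := rel_exclusive q.
have mxp : kronecker_mx Rp = corner 1%:M.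
  rewrite /kronecker_mx (eq_is_perm_rel RpE) (eq_perm_equiv _ RpE) equiv_refl.
  by move: pp; rewrite equiv_refl andbT => ->.
have mxq : kronecker_mx Rq = corner (jordan k n).
  rewrite /kronecker_mx (eq_is_perm_rel RqE) !(eq_perm_equiv _ RqE) equiv_refl.
  by move: qq pq'; rewrite equiv_refl !andbT => -> ->.
have stable V R : submod (projT2 kronecker_module) V ->
    (V *m kronecker_mx R <= V)%MS.
  (* The basis element of the algebra given by R acts as [kronecker_mx R]. *)
  by move=> /(_ [ffun S => (S == R)%:R]) /=; rewrite linear_ext_delta.
have [||||||->|->] := @corner_indecomposable k n U W; rewrite ?mxrank0; auto.
- by rewrite -mxp stable.
- by rewrite -mxp stable.
- by rewrite -mxq stable.
- by rewrite -mxq stable.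
- by apply/eqP; rewrite -mxrank_eq0 capUW.
- by rewrite /row_full addUW.
Qed.

End KroneckerModule.

(** * Infinite type from unbounded dimensions *)

Lemma mod_iso_dim (d : Order.disp_t) (L : finTBDistrLatticeType d) (X : finType)
  (k : fieldType) (M N : fdmod L X k) : mod_iso M N -> projT1 M = projT1 N.
Proof.
case=> P [Q [PQ [QP _]]]; apply/eqP; rewrite eqn_leq.
by rewrite (mulmx1_min PQ) (mulmx1_min QP).
Qed.

(** A finite list of modules has a largest dimension, and isomorphic modules have equal
    dimensions. *)
Lemma infinite_rep_type_unbounded (d : Order.disp_t)
  (L : finTBDistrLatticeType d) (X : finType) (k : fieldType) :
  (forall n, exists2 M : fdmod L X k, indecomposable M & (n < projT1 M)%N) ->
  infinite_rep_type L X k.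
Proof.
move=> unbounded [s sP].
have [M /sP[i lt_is /mod_iso_dim dimM]] := unbounded (\max_(N <- s) projT1 N).
have le_max (s' : seq (fdmod L X k)) (j : nat) : (j < size s')%N ->
    (projT1 (nth M s' j) <= \max_(N <- s') projT1 N)%N.
  elim: s' j => [|N s' IH] [|j] //=; rewrite big_cons leq_max ?leqnn // => /IH->.
  by rewrite orbT.
by rewrite dimM ltnNge le_max.
Qed.

Theorem theorem11 (X : finType) (d : Order.disp_t) (L : finTBDistrLatticeType d)
  (k : fieldType) :
  (3 < #|X|)%N -> (1 < #|L|)%N -> infinite_rep_type L X k.
Proof.
move=> X_gt3 L_gt1; have [a a_neq0 a_prime] := exists_join_prime L_gt1.
(* [t 3] and [t 4] give the 3-cycle and the 4-cycle, with [branching] 3 and 4; the latter needs four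
   elements in X. *)
pose t m := take m (enum X).
have Ut m : uniq (t m) by rewrite take_uniq ?enum_uniq.
have size_t m : (m <= 4)%N -> size (t m) = m.
  by move=> m4; rewrite size_takel // -cardE (leq_trans m4).
have prime_t m : (2 < m)%N -> (m <= 4)%N -> prime_rel (cycle_rel (t m)).
  by move=> m2 m4; apply: prime_cycle_rel; rewrite ?size_t.
have branch_t m : (2 < m)%N -> (m <= 4)%N -> branching (cycle_rel (t m)) = m.
  by move=> m2 m4; rewrite branching_cycle ?size_t.
have [neq0_3 neq0_4 neq34] : [/\ branching (cycle_rel (t 3)) != 0%N,
    branching (cycle_rel (t 4)) != 0%N
  & branching (cycle_rel (t 3)) != branching (cycle_rel (t 4))].
  by rewrite !branch_t.
apply: infinite_rep_type_unbounded => n.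
exists (kronecker_module k a_neq0 a_prime (prime_t 3 isT isT) (prime_t 4 isT isT)
  neq0_3 neq0_4 neq34 n).
  exact: kronecker_module_indecomposable.
by rewrite /= -addSnnS ltn_addr.
Qed.
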